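(* Let $C$ be an $(n,k)$-linear code over $GF(2)$ which contains the all-ones vector $\mathbf{1}$ and whose codewords have exactly $s$ distinct nonzero Hamming weights. Then $\phi(C)$ is an $\lfloor s/2\rfloor$-distance set of size $|C|/2$ in $\mathbb{R}^n$.
   Context: An $(n,k)$-linear code over $GF(2)$ is a $k$-dimensional subspace of $GF(2)^n$. For $c=(c_1,\dots,c_n)\in GF(2)^n$, $\phi(c):=((-1)^{c_1},\dots,(-1)^{c_n})\in\mathbb{R}^n$. Vectors are normalized to unit length and considered projectively: two vectors spanning the same one-dimensional subspace are identified, and the size of $\phi(C)$ is the number of distinct lines spanned by the vectors $\phi(c)$, $c\in C$. A set $X$ of unit vectors spanning pairwise distinct lines is an $m$-distance set if $\{(x^Ty)^2:x,y\in X,x\neq y\}$ has exactly $m$ elements. *)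

(* Defs.v *)
From HB Require Import structures.
From mathcomp Require Import all_boot all_order all_algebra.
From mathcomp Require Import finmap boolp classical_sets functions cardinality.
From mathcomp Require Import reals.

Set Implicit Arguments.
Unset Strict Implicit.
Unset Printing Implicit Defensive.

Import Order.TTheory GRing.Theory Num.Theory.

Local Open Scope classical_set_scope.
Local Open Scope fset_scope.
Local Open Scope ring_scope.

Definition hamming_weight (n : nat) (c : 'rV['F_2]_n) : nat :=
  #|[pred i : 'I_n | c 0 i != 0]|.

Definition nonzero_weights (n : nat) (C : {vspace 'rV['F_2]_n}) : {fset nat} :=
  [fset hamming_weight c | c in C & hamming_weight c != 0%N].

(* The exponent is the representative in {0, 1} of the bit [c 0 i]. *)
Definition phi (R : realType) (n : nat) (c : 'rV['F_2]_n) : 'cV[R]_n :=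
  \col_i (-1) ^+ (c 0 i : nat).

(* phi(C), considered projectively: the set of lines spanned by the phi(c). *)
Definition phi_lines (R : realType) (n : nat) (C : {vspace 'rV['F_2]_n}) :
    {fset {vspace 'cV[R]_n}} :=
  [fset <[phi R c]>%VS | c in C].

Definition dotp (R : realType) (n : nat) (x y : 'cV[R]_n) : R :=
  (x^T *m y) 0 0.

Definition unit_line_system (R : realType) (n : nat) (X : set 'cV[R]_n) : Prop :=
  (forall x, X x -> dotp x x = 1) /\
  (forall x y, X x -> X y -> x <> y -> <[x]>%VS <> <[y]>%VS).

Definition distance_set (R : realType) (n m : nat) (X : set 'cV[R]_n) : Prop :=
  unit_line_system X /\
  ([set a : R | exists x y, [/\ X x, X y, x <> y & a = dotp x y ^+ 2]] #= `I_m)%card.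

(* X consists of exactly one unit vector on each of the lines in L. *)
Definition represents (R : realType) (n : nat)
    (X : set 'cV[R]_n) (L : {fset {vspace 'cV[R]_n}}) : Prop :=
  unit_line_system X /\ [set <[x]>%VS | x in X] = [set` L].

(* A set of lines inherits the property from its systems of unit
   representatives; which representatives are taken must not matter, and the
   existence clause keeps the universal one from holding vacuously. *)
Definition projective_distance_set (R : realType) (n m : nat)
    (L : {fset {vspace 'cV[R]_n}}) : Prop :=
  (exists X, represents X L) /\
  (forall X, represents X L -> distance_set m X).

(* Main.v *)
(* For codewords c, d the inner product of phi(c) and phi(d) is n - 2 wt(c - d),
   so phi(c) and phi(d) span the same line iff c - d is 0 or 1.  Thus each line
   comes from exactly two codewords, and one of them vanishes at the first
   coordinate.  The squared angles are the ((n - 2w)/n)^2 for the weights w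
   other than 0 and n; two weights give the same value iff they are equal or add
   up to n.  The set of these s - 1 weights is stable under w |-> n - w, which
   has at most one fixed point, n/2, hence it has floor(s/2) orbits. *)
Require Import Defs.
From HB Require Import structures.
From mathcomp Require Import all_boot all_order all_algebra.
From mathcomp Require Import finmap boolp classical_sets functions cardinality.
From mathcomp Require Import reals.
From mathcomp Require Import zify ring.

Set Implicit Arguments.
Unset Strict Implicit.
Unset Printing Implicit Defensive.

Import Order.TTheory GRing.Theory Num.Theory.

Local Open Scope classical_set_scope.
Local Open Scope fset_scope.
Local Open Scope ring_scope.

(** * Bits of GF(2) and their signs *)

Lemma F2_ind (P : 'F_2 -> Prop) : P 0 -> P 1 -> forall a, P a.
Proof.
move=> P0 P1 [[|[|//]] lt_m].
- by rewrite (_ : Ordinal lt_m = 0) //; apply: val_inj.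
- by rewrite (_ : Ordinal lt_m = 1) //; apply: val_inj.
Qed.

Lemma signF2B (R : pzRingType) (a b : 'F_2) :
  (-1) ^+ (a - b)%R = (-1) ^+ a * (-1) ^+ b :> R.
Proof.
move: a b; apply: F2_ind; apply: F2_ind;
  by rewrite ?subrr ?subr0 ?sub0r /= ?expr0 ?expr1 ?mulr1 ?mul1r ?mulrNN ?mulr1.
Qed.

Lemma signF2E (R : pzRingType) (a : 'F_2) :
  (-1) ^+ a = 1 - (a != 0)%:R *+ 2 :> R.
Proof.
move: a; apply: F2_ind; rewrite ?eqxx ?oner_eq0 /= ?expr0 ?expr1.
- by rewrite mul0rn subr0.
- by rewrite mulr2n opprD addrA subrr sub0r.
Qed.

Lemma signF2_inj (R : numDomainType) :
  injective (fun a : 'F_2 => (-1) ^+ a : R).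
Proof.
have neq1 : (1 : R) <> -1 by move/eqP; rewrite -subr_eq0 opprK paddr_eq0 ?ler01 // oner_eq0.
apply: F2_ind; apply: F2_ind => //=; rewrite ?expr0 ?expr1 => // /esym //.
Qed.

(** * Hamming weights and complementation *)

Section Weights.
Variable n : nat.
Implicit Types c d : 'rV['F_2]_n.

Lemma hamming_weightE c : hamming_weight c = (\sum_i (c ord0 i != 0)%R)%N.
Proof.
rewrite /hamming_weight -sum1_card big_mkcond /=.
by apply: eq_bigr => i _; rewrite inE; case: (_ != _).
Qed.

Lemma hamming_weight_le c : (hamming_weight c <= n)%N.
Proof. by rewrite /hamming_weight (leq_trans (max_card _)) ?card_ord. Qed.

Lemma hamming_weight_eq0 c : (hamming_weight c == 0)%N = (c == 0).
Proof.
apply/eqP/eqP => [w0|->]; last first.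
  by rewrite hamming_weightE big1 // => i _; rewrite mxE eqxx.
apply/rowP => i; rewrite mxE; apply/eqP/negPn.
by have /negbT := card0_eq w0 i; rewrite inE.
Qed.

Lemma hamming_weight_compl c :
  (hamming_weight (const_mx 1 - c)%R + hamming_weight c = n)%N.
Proof.
rewrite !hamming_weightE -big_split /= -[RHS]card_ord -sum1_card.
apply: eq_bigr => i _; rewrite !mxE.
by move: (c ord0 i); apply: F2_ind; rewrite ?subrr ?subr0 ?eqxx ?oner_eq0.
Qed.

(** The weights of [c] and of its complement add up to [n], so this is the weight-zero criterion
    applied to the complement. *)
Lemma hamming_weight_eqn c : (hamming_weight c == n)%N = (c == const_mx 1).
Proof.
rewrite -{2}(hamming_weight_compl c) -{1}[hamming_weight c]add0n eqn_add2r eq_sym.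
by rewrite hamming_weight_eq0 subr_eq0 eq_sym.
Qed.

End Weights.

(** * Inner products of sign vectors and the lines they span *)

Section Phi.
Variables (R : realType) (n : nat).
Implicit Types (c d : 'rV['F_2]_n) (x y : 'cV[R]_n).

Lemma dotpE x y : dotp x y = \sum_i x i ord0 * y i ord0.
Proof. by rewrite /dotp mxE; apply: eq_bigr => i _; rewrite mxE. Qed.

Lemma dotpZ a b x y : dotp (a *: x) (b *: y) = a * b * dotp x y.
Proof.
by rewrite !dotpE mulr_sumr; apply: eq_bigr => i _; rewrite !mxE mulrACA.
Qed.

Lemma dotp0l y : dotp 0 y = 0.
Proof. by rewrite /dotp trmx0 mul0mx mxE. Qed.

(** The product of the two signs at coordinate [i] is the sign of the bit of [c - d] there, which is
    1 minus twice the indicator that this bit is nonzero. *)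
Lemma dotp_phi c d :
  dotp (phi R c) (phi R d) = n%:R - (hamming_weight (c - d))%:R *+ 2.
Proof.
rewrite dotpE hamming_weightE natr_sum -sumrMnl.
rewrite -[n in n%:R]card_ord -sum1_card natr_sum -sumrB.
by apply: eq_bigr => i _; rewrite !mxE -signF2B signF2E.
Qed.

Lemma dotp_phi_self c : dotp (phi R c) (phi R c) = n%:R.
Proof.
rewrite dotp_phi subrr hamming_weightE big1 ?mul0rn ?subr0 // => i _.
by rewrite mxE eqxx.
Qed.

Lemma phi_compl c : phi R (const_mx 1 - c) = - phi R c.
Proof. by apply/colP => i; rewrite !mxE signF2B expr1 mulN1r. Qed.

Lemma vline_eq_scale x y : x != 0 ->
  <[x]>%VS = <[y]>%VS -> exists2 a : R, a != 0 & x = a *: y.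
Proof.
move=> x0 xy; have /vlineP[a xE] : x \in <[y]>%VS by rewrite -xy memv_line.
by exists a => //; apply: contra x0 => /eqP a0; rewrite xE a0 scale0r.
Qed.

Lemma vlineZ a x : a != 0 -> <[a *: x]>%VS = <[x]>%VS.
Proof.
move=> a0; apply/eqP; rewrite eqEsubv -!memvE memvZ ?memv_line //=.
by apply/vlineP; exists a^-1; rewrite scalerA mulVf // scale1r.
Qed.

Lemma vline_phi_compl c : <[phi R (const_mx 1 - c)]>%VS = <[phi R c]>%VS.
Proof. by rewrite phi_compl -scaleN1r vlineZ // oppr_eq0 oner_eq0. Qed.

Hypothesis n_gt0 : (0 < n)%N.

Lemma phi_neq0 c : phi R c != 0.
Proof.
apply/eqP => c0; have := dotp_phi_self c; rewrite c0 dotp0l.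
by move=> /esym/eqP; rewrite pnatr_eq0 gtn_eqF.
Qed.

(** If [phi R c = a *: phi R d], every bit of [c - d] has sign [a]; since a sign determines its bit,
    all bits of [c - d] agree. *)
Lemma vline_phi_eq c d :
  <[phi R c]>%VS = <[phi R d]>%VS -> exists a : 'F_2, c - d = const_mx a.
Proof.
move=> /(vline_eq_scale (phi_neq0 c))[a _ /colP cd].
have sgnB i : (-1) ^+ ((c - d)%R ord0 i) = a.
  by have := cd i; rewrite !mxE signF2B => ->; rewrite -mulrA -signF2B subrr mulr1.
exists ((c - d) ord0 (Ordinal n_gt0)); apply/rowP => i; rewrite [RHS]mxE.
by apply: (@signF2_inj R); rewrite !sgnB.
Qed.

Lemma vline_phi_eqP c d :
  <[phi R c]>%VS = <[phi R d]>%VS <-> c - d = 0 \/ c - d = const_mx 1.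
Proof.
split=> [/vline_phi_eq[a]|[/eqP|/eqP]].
- by move: a; apply: F2_ind => ->; [left; apply/rowP => i; rewrite !mxE|right].
- by rewrite subr_eq0 => /eqP ->.
(* Here [c] is the all-ones word plus [d], whose complement is [- d], and [- d = d] in
   characteristic 2. *)
- rewrite subr_eq => /eqP ->; rewrite -vline_phi_compl.
  by rewrite opprD addrA subrr sub0r -scaleN1r (_ : -1 = 1 :> 'F_2) ?scale1r //; apply: val_inj.
Qed.

(** The squared cosine of the angle between the lines of two words at Hamming distance [w]. *)
Definition angle (w : nat) : R := ((n%:R - w%:R *+ 2) / n%:R) ^+ 2.

Lemma angle_compl w : (w <= n)%N -> angle (n - w) = angle w.
Proof. by move=> wn; rewrite /angle natrB //; ring. Qed.

(** For [w] at most [n / 2] the number being squared is nonnegative, and squaring is injective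
    there. *)
Lemma angle_inj : {in [pred w | (w.*2 <= n)%N] &, injective angle}.
Proof.
have n0 : n%:R != 0 :> R by rewrite pnatr_eq0 -lt0n.
have ge0 u : (u.*2 <= n)%N -> 0 <= (n%:R - u%:R *+ 2) / n%:R :> R.
  move=> un; rewrite divr_ge0 ?ler0n // subr_ge0 -mulrnA ler_nat; lia.
move=> v w; rewrite !inE => vn wn /eqP.
rewrite eqrXn2 ?ge0 // => /eqP /(mulIf (invr_neq0 n0)) /addrI /oppr_inj /eqP.
by rewrite -!mulrnA eqr_nat => /eqP; lia.
Qed.

(** Write [x = a *: phi R c] and [y = b *: phi R d]. Unit length forces [a * a = b * b = 1 / n], so
    [a] and [b] are known up to sign, and squaring the inner product removes the signs. *)
Lemma dotp_unit_sqr x y c d :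
  dotp x x = 1 -> dotp y y = 1 ->
  <[x]>%VS = <[phi R c]>%VS -> <[y]>%VS = <[phi R d]>%VS ->
  dotp x y ^+ 2 = angle (hamming_weight (c - d)).
Proof.
have nz (z : 'cV[R]_n) : dotp z z = 1 -> z != 0.
  move=> z1; apply/eqP => z0; move: z1; rewrite z0 dotp0l => /eqP.
  by rewrite eq_sym oner_eq0.
have n0 : n%:R != 0 :> R by rewrite pnatr_eq0 -lt0n.
move=> x1 y1 /(vline_eq_scale (nz _ x1))[a _ xE] /(vline_eq_scale (nz _ y1))[b _ yE].
move: x1 y1; rewrite /angle xE yE !dotpZ !dotp_phi_self dotp_phi => a1 b1.
have -> : n%:R^-1 = a * a :> R by apply: (mulIf n0); rewrite mulVf.
have ab : a * a = b * b by apply: (mulIf n0); rewrite a1 b1.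
set D := n%:R - _; transitivity (a * a * (b * b) * D ^+ 2); first by ring.
by rewrite -ab; ring.
Qed.

(** * The lines of a code containing the all-ones word *)

Section Code.
Variable C : {vspace 'rV['F_2]_n}.
Hypothesis ones_in_C : const_mx 1 \in C.

Let i0 := Ordinal n_gt0.
Let half : pred 'rV['F_2]_n := [pred c in C | c ord0 i0 == 0].

Lemma vline_phi_half_inj : {in half &, injective (fun c => <[phi R c]>%VS)}.
Proof.
move=> c d /andP[_ /eqP c0] /andP[_ /eqP d0] /vline_phi_eqP[/eqP|cd].
  by rewrite subr_eq0 => /eqP.
by have /rowP/(_ i0)/eqP := cd; rewrite !mxE c0 d0 subrr eq_sym oner_eq0.
Qed.

Lemma mem_ones_compl c : c \in C -> const_mx 1 - c \in C.
Proof. exact: memvB. Qed.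

Lemma phi_lines_half : phi_lines R C = [fset <[phi R c]>%VS | c in half].
Proof.
apply/fsetP => L; apply/imfsetP/imfsetP => /= -[c cP ->]; last first.
  by exists c => //; case/andP: cP.
have [c0|c0] := eqVneq (c ord0 i0) 0; first by exists c => //; rewrite inE cP c0 eqxx.
exists (const_mx 1 - c); last by rewrite vline_phi_compl.
rewrite inE mem_ones_compl //= !mxE.
by move: c0; move: (c _ _); apply: F2_ind; rewrite ?eqxx // subrr.
Qed.

(** Complementation maps [half] bijectively onto the codewords whose first bit is 1. *)
Lemma card_half : #|C| = (#|half|).*2.
Proof.
rewrite -addnn -(cardID [pred c : 'rV['F_2]_n | c ord0 i0 == 0] C); congr addn.
rewrite -(card_imset half (@subrI _ (const_mx 1))); apply: eq_card => c; rewrite !inE.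
apply/andP/imsetP => [[c0 cC]|[d /andP[dC /eqP d0] ->]].
  exists (const_mx 1 - c); last by rewrite subKr.
  rewrite inE mem_ones_compl //= !mxE.
  by move: c0; move: (c _ _); apply: F2_ind; rewrite ?eqxx // subrr.
by rewrite mem_ones_compl // !mxE d0 subr0 oner_eq0.
Qed.

Lemma card_phi_lines : #|C| = (#|` phi_lines R C|).*2.
Proof.
rewrite card_half phi_lines_half card_in_imfset /=; last exact: vline_phi_half_inj.
by rewrite cardE.
Qed.

Lemma represents_phi_lines : exists X, represents X (phi_lines R C).
Proof.
have r_neq0 : (Num.sqrt n%:R)^-1 != 0 :> R.
  by rewrite invr_eq0 sqrtr_eq0 -ltNge ltr0n.
(* Each sign vector has squared length [n]; restricting to [half] keeps one codeword per line. *)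
exists [set (Num.sqrt n%:R)^-1 *: phi R c | c in [set c | half c]]%classic.
split; [split|].
- move=> _ [c _ <-]; rewrite dotpZ dotp_phi_self -invfM -expr2 sqr_sqrtr ?ler0n //.
  by rewrite mulVf // pnatr_eq0 -lt0n.
- move=> _ _ [c hc <-] [d hd <-] cd; rewrite !vlineZ // => cdE; apply: cd.
  by rewrite (vline_phi_half_inj hc hd cdE).
- rewrite phi_lines_half; apply/seteqP; split=> L /=.
    move=> [_ [c hc <-] <-]; rewrite vlineZ //; exact: in_imfset.
  case/imfsetP => c hc ->; exists ((Num.sqrt n%:R)^-1 *: phi R c); last by rewrite vlineZ.
  by exists c.
Qed.

(** * Weights of the code and the angles they produce *)

Lemma nonzero_weightsP w :
  reflect (exists2 c, c \in C & c != 0 /\ w = hamming_weight c)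
          (w \in nonzero_weights C).
Proof.
apply: (iffP (imfsetP _ _ _ _)) => /= [[c]|[c cC [c0 ->]]].
  by rewrite inE hamming_weight_eq0 => /andP[cC c0] ->; exists c.
by exists c => //; rewrite inE hamming_weight_eq0 cC.
Qed.

Lemma nonzero_weights_ones : n \in nonzero_weights C.
Proof.
apply/nonzero_weightsP; exists (const_mx 1) => //; split.
  by apply/eqP => /rowP/(_ i0)/eqP; rewrite !mxE oner_eq0.
by apply/esym/eqP; rewrite hamming_weight_eqn.
Qed.

Lemma nonzero_weights_bound w : w \in nonzero_weights C -> (0 < w <= n)%N.
Proof.
case/nonzero_weightsP => c _ [c0 ->].
by rewrite hamming_weight_le lt0n hamming_weight_eq0 c0.
Qed.

(** Realized by complementing a codeword; [w != n] keeps the complement from being the zero word. *)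
Lemma nonzero_weights_sym w :
  w \in nonzero_weights C -> w != n -> (n - w)%N \in nonzero_weights C.
Proof.
case/nonzero_weightsP => c cC [c0 ->]; rewrite hamming_weight_eqn => c1.
apply/nonzero_weightsP; exists (const_mx 1 - c); first exact: mem_ones_compl.
split; first by rewrite subr_eq0 eq_sym.
by rewrite -{1}(hamming_weight_compl c) addnK.
Qed.

(* One representative of each orbit of [w |-> n - w] on the weights other than
   0 and n. *)
Definition low_weights : {fset nat} :=
  [fset w in nonzero_weights C | (w != n) && (w.*2 <= n)%N].

Lemma angles_represents X : represents X (phi_lines R C) ->
  [set a : R | exists x y, [/\ X x, X y, x <> y & a = dotp x y ^+ 2]]%classic =
  [set angle w | w in [set` low_weights]]%classic.
Proof.
move=> [[X1 Xinj] XL].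
have Xline x : X x -> exists2 c, c \in C & <[x]>%VS = <[phi R c]>%VS.
  move=> Xx; have : [set` phi_lines R C]%classic <[x]>%VS by rewrite -XL; exists x.
  by case/imfsetP => c cC ->; exists c.
have Xrep c : c \in C -> exists2 x, X x & <[x]>%VS = <[phi R c]>%VS.
  move=> cC; suff : [set <[x]>%VS | x in X]%classic <[phi R c]>%VS by [].
  by rewrite XL /=; apply: in_imfset.
apply/seteqP; split=> a /=.
  move=> [x [y [Xx Xy xy ->]]].
  have [[c cC xc] [d dC yd]] := (Xline x Xx, Xline y Xy).
  rewrite (dotp_unit_sqr (X1 _ Xx) (X1 _ Xy) xc yd).
  have ncd : ~ (c - d = 0 \/ c - d = const_mx 1).
    by move=> /vline_phi_eqP; rewrite -xc -yd; apply: Xinj.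
  have cd0 : c - d != 0 by apply/eqP => cd; apply: ncd; left.
  have cd1 : hamming_weight (c - d) != n.
    by rewrite hamming_weight_eqn; apply/eqP => cd; apply: ncd; right.
  have wW : hamming_weight (c - d) \in nonzero_weights C.
    by apply/nonzero_weightsP; exists (c - d) => //; apply: memvB.
  have w_le := hamming_weight_le (c - d).
  have := nonzero_weights_bound wW => /andP[w_gt0 _].
  have [w_low|w_high] := leqP (hamming_weight (c - d)).*2 n.
    by exists (hamming_weight (c - d)) => //=; rewrite !inE /= wW cd1.
  (* A weight above [n / 2] is reflected to a low one with the same angle. *)
  exists (n - hamming_weight (c - d))%N; last exact: angle_compl.
  rewrite /= !inE /= nonzero_weights_sym //=; lia.
(* Conversely, a codeword of weight [w] lies at distance [w] from the zero codeword; as [w] is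
   neither 0 nor [n], the two lines differ. *)
move=> [w /=]; rewrite !inE /= => /and3P[/nonzero_weightsP[c cC [c0 ->]] c1 _] <-.
have [x Xx xc] := Xrep c cC; have [y Xy y0] := Xrep 0 (mem0v C).
exists x, y; split=> //; last by rewrite (dotp_unit_sqr (X1 _ Xx) (X1 _ Xy) xc y0) subr0.
move=> xy; move: y0; rewrite -xy xc => /vline_phi_eqP; rewrite subr0 => -[cE|cE].
  by rewrite cE eqxx in c0.
by rewrite hamming_weight_eqn cE eqxx in c1.
Qed.

(** The nonzero weights are [n], the low weights [T] and their reflections [T']. As [T] and [T']
    have equal size and share at most one element, their number is 1 + 2|T| or 2|T|, and halving
    with floor gives |T| either way. *)
Lemma card_low_weights : #|` low_weights| = (#|` nonzero_weights C| %/ 2)%N.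
Proof.
set T := low_weights; pose T' := [fset (n - w)%N | w in T].
have TP w : w \in T -> [/\ w \in nonzero_weights C, (0 < w < n)%N & (w.*2 <= n)%N].
  rewrite !inE /= => /and3P[wW wn ->]; split=> //.
  by have := nonzero_weights_bound wW; lia.
have cardT' : #|` T'| = #|` T|.
  by apply: card_in_imfset => v w /TP[_ v_lt _] /TP[_ w_lt _]; lia.
have WE : nonzero_weights C = n |` (T `|` T').
  apply/fsetP => w; rewrite in_fset1U in_fsetU.
  apply/idP/or3P => [wW|[/eqP ->|/TP[]//|/imfsetP[v /= /TP[vW v_lt _] ->]]].
  - have [->|wn] := eqVneq w n; first by constructor 1.
    have [w_low|w_high] := leqP w.*2 n.
      by constructor 2; rewrite !inE /= wW wn.
    have w_le := nonzero_weights_bound wW.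
    constructor 3; apply/imfsetP; exists (n - w)%N => /=; last by lia.
    rewrite !inE /= nonzero_weights_sym //=; lia.
  - exact: nonzero_weights_ones.
  - by apply: nonzero_weights_sym => //; lia.
have nT : n \notin T `|` T'.
  rewrite in_fsetU; apply/norP; split; apply/negP.
    by case/TP; lia.
  by case/imfsetP => v /= /TP[_ v_lt _]; lia.
(* If [w = n - v] with both [w] and [v] at most [n / 2], then [w] is exactly [n / 2]. *)
have TI : (#|` T `&` T'| <= 1)%N.
  rewrite -(cardfs1 n./2); apply/fsubset_leq_card/fsubsetP => w.
  rewrite in_fsetI => /andP[/TP[_ _ w_low] /imfsetP[v /= /TP[_ v_lt v_low] wE]].
  by rewrite in_fset1; apply/eqP; lia.
rewrite WE cardfsU1 nT cardfsU cardT'.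
have := fsubset_leq_card (fsubsetIl T T'); lia.
Qed.

End Code.
End Phi.

Theorem corollary4p3p6 (R : realType) (n k s : nat)
    (C : {vspace 'rV['F_2]_n})
    (n_gt0 : (0 < n)%N)
    (dimC : \dim C = k)
    (ones_in_C : const_mx 1 \in C)
    (sC : #|` nonzero_weights C| = s) :
  projective_distance_set (s %/ 2) (phi_lines R C) /\
  #|` phi_lines R C|%:R = #|C|%:R / 2 :> rat.
Proof.
split; last by rewrite (card_phi_lines R n_gt0 ones_in_C) -muln2 natrM mulfK.
split; first exact: represents_phi_lines.
move=> X repX; split; first by case: repX.
rewrite (angles_represents n_gt0 ones_in_C repX).
(* Low weights do not exceed [n / 2], so distinct ones give distinct angles and the angles are as
   many as the low weights. *)
have inj : {in [set` low_weights C]%classic &, injective (angle R n)}.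
  apply: (sub_in2 _ (angle_inj n_gt0)) => w.
  by rewrite !inE /= !inE /= => /and3P[].
apply: (card_eq_trans (inj_card_eq inj)).
by apply/card_eq_fsetP; rewrite card_low_weights // sC.
Qed.
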